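(* D-APEP$\langle\mathsf{BoD_E}\rangle$ is polynomial-time solvable.
   Context: D-APEP. An instance consists of a finite set $U$ of users, a finite set $R$ of resources, a base authorization relation $A_{\sf Bse}\subseteq U\times R$ with $A_{\sf Bse}(r)\neq\emptyset$ for all $r\in R$, and a set $C$ of constraints. For $A\subseteq U\times R$, $A(r)=\{u\in U:(u,r)\in A\}$. $A$ is authorized if $A\subseteq A_{\sf Bse}$, complete if $A(r)\ne\emptyset$ for all $r\in R$, eligible if it satisfies every $c\in C$, and valid if it is authorized, complete and eligible. The problem is to decide whether a valid $A$ exists and, if so, find one. $\mathsf{BoD_E}$ is the family of constraints $(r,r',\leftrightarrow,\exists)$ with $r,r'\in R$; such a constraint is satisfied by a complete $A$ iff $A(r)\cap A(r')\neq\emptyset$. D-APEP$\langle\mathsf{BoD_E}\rangle$ is the restriction to instances in which all constraints are $\mathsf{BoD_E}$ constraints. *)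

(* Defs.v *)
From HB Require Import structures.
From mathcomp Require Import all_boot.
Set Implicit Arguments.
Unset Strict Implicit.
Unset Printing Implicit Defensive.

(** * Deterministic multi-tape Turing machines *)

Inductive move := MoveLeft | Stay | MoveRight.

(* [None] is the blank; besides the symbols of [S], in which inputs and outputs
   are written, a machine may use finitely many work symbols [W]. *)
Definition cell (S W : Type) := option (S + W).

(* A two-way infinite tape: the cells to the left of the head (nearest first),
   the scanned cell, the cells to its right (nearest first); all cells beyond
   the two lists are blank. *)
Record tape (S W : Type) := Tape {
  tleft : seq (cell S W);
  thead : cell S W;
  tright : seq (cell S W) }.

(* Tapes are numbered 0, ..., ntapes, so there is at least one; the input is on
   tape 0 and the output on tape ntapes. *)
Record tm (S : finType) := TM {
  ntapes : nat;
  state : finType;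
  work : finType;
  start : state;
  halting : pred state;
  trans : state -> {ffun 'I_ntapes.+1 -> cell S work} ->
          state * {ffun 'I_ntapes.+1 -> cell S work * move} }.

Section Tapes.
Variables S W : Type.
Implicit Types (t : tape S W) (s : seq (cell S W)).

Definition write t (a : cell S W) : tape S W := Tape (tleft t) a (tright t).

Definition move_head t (m : move) : tape S W :=
  match m with
  | Stay => t
  | MoveLeft =>
      Tape (behead (tleft t)) (head None (tleft t)) (thead t :: tright t)
  | MoveRight =>
      Tape (thead t :: tleft t) (head None (tright t)) (behead (tright t))
  end.

Definition blank_tape : tape S W := Tape [::] None [::].

(* The head scans the first symbol of the word. *)
Definition word_tape (w : seq S) : tape S W :=
  let s := [seq Some (inl a) | a <- w] in Tape [::] (head None s) (behead s).

Fixpoint word_prefix s : seq S :=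
  if s is Some (inl a) :: s' then a :: word_prefix s' else [::].

(* The word that starts at the head and extends to the right up to the first
   blank or work symbol. *)
Definition tape_word t : seq S := word_prefix (thead t :: tright t).

End Tapes.

Section Run.
Variables (S : finType) (M : tm S).

Record config := Config {
  cstate : state M;
  ctapes : {ffun 'I_(ntapes M).+1 -> tape S (work M)} }.

Definition init (w : seq S) : config :=
  Config (start M)
    [ffun i => if i == ord0 then word_tape (work M) w else blank_tape S (work M)].

Definition halted (c : config) : bool := halting (cstate c).

Definition step (c : config) : config :=
  if halted c then c else
  let r := trans (cstate c) [ffun i => thead (ctapes c i)] in
  Config r.1
    [ffun i => move_head (write (ctapes c i) (r.2 i).1) (r.2 i).2].

Definition output (c : config) : seq S := tape_word (ctapes c ord_max).

(* On input [w], the machine halts after at most [t] steps with output [v]. *)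
Definition computes_within (w : seq S) (t : nat) (v : seq S) : Prop :=
  let c := iter t step (init w) in halted c /\ output c = v.

End Run.

(** * Polynomial-time solvable problems *)

(* The task on [x : instance] is to decide whether some candidate [y] satisfies
   [solution y] and, if so, to find one; [encode_answer None] stands for the
   answer that there is none. *)
Record search_problem (S : finType) := SearchProblem {
  instance : Type;
  encode : instance -> seq S;
  candidate : instance -> Type;
  solution : forall x, candidate x -> Prop;
  encode_answer : forall x, option (candidate x) -> seq S }.
Arguments solution {S s x} _.
Arguments encode_answer {S s x} _.

Definition correct_answer (S : finType) (P : search_problem S) (x : instance P)
    (a : option (candidate x)) : Prop :=
  match a with
  | Some y => solution y
  | None => forall y : candidate x, ~ solution y
  end.

Definition polynomial_time_solvable (S : finType) (P : search_problem S) : Prop :=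
  exists (M : tm S) (c d : nat), forall x : instance P,
    exists2 a : option (candidate x), correct_answer a &
      computes_within M (encode x) (c * size (encode x) ^ d + c)
        (encode_answer a).

(** * Encodings *)

Inductive symbol := Zero | One | Comma | Semicolon | Bar.

Definition symbol_rank (a : symbol) : 'I_5 :=
  match a with
  | Zero => @Ordinal 5 0 isT | One => @Ordinal 5 1 isT
  | Comma => @Ordinal 5 2 isT | Semicolon => @Ordinal 5 3 isT
  | Bar => @Ordinal 5 4 isT
  end.

Definition symbol_unrank (i : 'I_5) : symbol :=
  nth Bar [:: Zero; One; Comma; Semicolon] i.

Lemma symbol_rankK : cancel symbol_rank symbol_unrank.
Proof. by case. Qed.

HB.instance Definition _ := Countable.copy symbol (can_type symbol_rankK).
HB.instance Definition _ : isFinite symbol := CanIsFinite symbol_rankK.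

Fixpoint encode_positive (p : BinNums.positive) : seq symbol :=
  match p with
  | BinNums.xH => [:: One]
  | BinNums.xO q => rcons (encode_positive q) Zero
  | BinNums.xI q => rcons (encode_positive q) One
  end.

Definition encode_nat (n : nat) : seq symbol :=
  if bin_of_nat n is BinNums.Npos p then encode_positive p else [:: Zero].

(* An element of a finite set is named by its index, in binary. *)
Definition encode_elt (T : finType) (x : T) : seq symbol :=
  encode_nat (enum_rank x).

Definition encode_pair (T T' : finType) (x : T * T') : seq symbol :=
  encode_elt x.1 ++ Comma :: encode_elt x.2.

Definition encode_list (T : Type) (f : T -> seq symbol) (s : seq T) : seq symbol :=
  flatten [seq rcons (f x) Semicolon | x <- s].

(** * The Authorization Policy Existence Problem *)

Section Authorization.
Variables U R : finType.
Implicit Types (A : {set U * R}) (r : R).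

Definition authorized_users A r : {set U} := [set u | (u, r) \in A].

Definition authorized (Abse A : {set U * R}) : bool := A \subset Abse.

Definition complete A : bool := [forall r, authorized_users A r != set0].

End Authorization.

(* [satisfies] is only meaningful for complete relations. *)
Record constraint_family := ConstraintFamily {
  constraint : finType -> finType -> eqType;
  satisfies : forall U R : finType, {set U * R} -> constraint U R -> bool;
  encode_constraint : forall U R : finType, constraint U R -> seq symbol }.

(* The finite set of constraints is given by a duplicate-free list. *)
Record apep (F : constraint_family) := Apep {
  users : finType;
  resources : finType;
  base : {set users * resources};
  base_nonempty : forall r, authorized_users base r != set0;
  constraints : seq (constraint F users resources);
  constraints_uniq : uniq constraints }.

Section DAPEP.
Variable F : constraint_family.
Implicit Type I : apep F.

Definition eligible I (A : {set users I * resources I}) : bool :=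
  all (satisfies A) (constraints I).

Definition valid I (A : {set users I * resources I}) : bool :=
  [&& authorized (base I) A, complete A & eligible A].

Definition encode_apep I : seq symbol :=
  encode_list (@encode_elt (users I)) (enum (users I)) ++ Bar ::
  encode_list (@encode_elt (resources I)) (enum (resources I)) ++ Bar ::
  encode_list (@encode_pair (users I) (resources I)) (enum (base I)) ++ Bar ::
  encode_list (@encode_constraint F (users I) (resources I)) (constraints I).

Definition encode_apep_answer I (a : option {set users I * resources I}) :
    seq symbol :=
  if a is Some A then
    One :: encode_list (@encode_pair (users I) (resources I)) (enum A)
  else [:: Zero].

Definition D_APEP : search_problem symbol :=
  @SearchProblem symbol (apep F) encode_apep
    (fun I => {set users I * resources I}) (fun I A => @valid I A)
    encode_apep_answer.

End DAPEP.

Arguments eligible {F} I A.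
Arguments valid {F} I A.

(* The pair [(r, r')] stands for the constraint (r, r', <->, exists). *)
Definition BoD_E : constraint_family :=
  @ConstraintFamily (fun _ R => (R * R)%type : eqType)
    (fun _ _ A c => authorized_users A c.1 :&: authorized_users A c.2 != set0)
    (fun _ R c => encode_pair c).

(* Main.v *)
(* A constraint (r, r', <->, exists) remains satisfied when the relation grows,
   so there is a valid relation iff the base relation itself is valid.  The
   machine keeps two copies of the encoded base relation and, for each
   constraint and each pair of entries (u, r), (u', r'), compares the three words
   in one left-to-right pass over three tapes; a fourth tape holds the output,
   with a flag in the cell after it. *)
Require Import Defs.
From mathcomp Require Import all_boot zify.

Set Implicit Arguments.
Unset Strict Implicit.
Unset Printing Implicit Defensive.

(** * Structured programs on four tapes *)

(** Completeness of the base relation is part of an instance, so only its eligibility has to be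
    decided. Two copies are needed because the entries of a pair sit at independent positions of the
    same list. For input length [N], three nested loops of at most [N] rounds each, around a
    comparison in time linear in [N], give the degree 4.

    Machines are assembled by sequence, test and loop, each with a rule for [runs], which is
    reachability within a time bound. The memory is a four-tuple and not a finite function because
    [get] and [set] then reduce, so the tapes after each step are found by computation.

    The positive answer is written before anything is checked. The flag cell behind it is finally
    either blank, and so ends that answer, or [Zero], which by itself is the negative answer; it
    remains to put the head in the right place. *)

Record quad (T : Type) := Quad { tape0 : T; tape1 : T; tape2 : T; tape3 : T }.

(* Every index from 3 on denotes the last component. *)
Definition get T (q : quad T) (i : nat) : T :=
  match i with 0 => tape0 q | 1 => tape1 q | 2 => tape2 q | _ => tape3 q end.

Definition set T (q : quad T) (i : nat) (x : T) : quad T :=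
  match i with
  | 0 => Quad x (tape1 q) (tape2 q) (tape3 q)
  | 1 => Quad (tape0 q) x (tape2 q) (tape3 q)
  | 2 => Quad (tape0 q) (tape1 q) x (tape3 q)
  | _ => Quad (tape0 q) (tape1 q) (tape2 q) x
  end.

Definition quad_map T T' (f : T -> T') (q : quad T) : quad T' :=
  Quad (f (tape0 q)) (f (tape1 q)) (f (tape2 q)) (f (tape3 q)).

Lemma get_set T (q : quad T) i x : get (set q i x) i = x.
Proof. by case: i => [|[|[|i]]]. Qed.

Lemma get_set_neq T (q : quad T) i j x :
  i < 4 -> j < 4 -> i != j -> get (set q i x) j = get q j.
Proof. by case: i j => [|[|[|[|?]]]] [|[|[|[|?]]]]. Qed.

Lemma set_set T (q : quad T) i x y : set (set q i x) i y = set q i y.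
Proof. by case: i => [|[|[|i]]]. Qed.

Lemma set_get T (q : quad T) i : set q i (get q i) = q.
Proof. by case: i q => [|[|[|i]]] []. Qed.

Lemma get_map T T' (f : T -> T') (q : quad T) i :
  get (quad_map f q) i = f (get q i).
Proof. by case: i => [|[|[|i]]]. Qed.

Section Machines.
Variable S : finType.

Local Notation cell := (cell S void).
Local Notation tape := (tape S void).
Local Notation memory := (quad tape).

(* The machine stops when the next state is [None]. *)
Record mach := Mach {
  mstate : finType;
  mstart : mstate;
  mnext : mstate -> quad cell -> option mstate * quad (cell * move) }.

Definition heads (m : memory) : quad cell := quad_map (@Defs.thead S void) m.

Definition update (t : tape) (a : cell * move) : tape :=
  move_head (write t a.1) a.2.

Definition update_all (m : memory) (a : quad (cell * move)) : memory :=
  Quad (update (tape0 m) (tape0 a)) (update (tape1 m) (tape1 a))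
       (update (tape2 m) (tape2 a)) (update (tape3 m) (tape3 a)).

Definition idle (h : quad cell) : quad (cell * move) :=
  quad_map (fun a => (a, Stay)) h.

Definition mstep M (c : option (mstate M) * memory) :=
  if c.1 is Some s then
    let r := mnext s (heads c.2) in (r.1, update_all c.2 r.2)
  else c.

Definition within M T (c c' : option (mstate M) * memory) : Prop :=
  exists2 k, k <= T & iter k (@mstep M) c = c'.

Definition runs M T (m m' : memory) : Prop :=
  within T (Some (mstart M), m) (None : option (mstate M), m').

Lemma update_idle (m : memory) : update_all m (idle (heads m)) = m.
Proof. by case: m => [[? ? ?] [? ? ?] [? ? ?] [? ? ?]]. Qed.

Lemma update_set_idle (m : memory) i a :
  update_all m (set (idle (heads m)) i a) = set m i (update (get m i) a).
Proof.
by case: i m => [|[|[|i]]] [[? ? ?] [? ? ?] [? ? ?] [? ? ?]].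
Qed.

Lemma within_trans M T1 T2 (c1 c2 c3 : option (mstate M) * memory) :
  within T1 c1 c2 -> within T2 c2 c3 -> within (T1 + T2) c1 c3.
Proof.
move=> [k1 le1 <-] [k2 le2 <-]; exists (k2 + k1); last by rewrite iterD.
by rewrite addnC leq_add.
Qed.

Lemma within_step M (c c' : option (mstate M) * memory) :
  mstep c = c' -> within 1 c c'.
Proof. by exists 1. Qed.

Lemma within_weaken M T1 T2 (c c' : option (mstate M) * memory) :
  T1 <= T2 -> within T1 c c' -> within T2 c c'.
Proof. by move=> le12 [k lek <-]; exists k => //; apply: leq_trans le12. Qed.

Lemma runs_weaken M T1 T2 m m' : T1 <= T2 -> runs M T1 m m' -> runs M T2 m m'.
Proof. exact: within_weaken. Qed.

Lemma mstep_None M k m : iter k (@mstep M) (None, m) = (None, m).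
Proof. by elim: k => //= k ->. Qed.

(* [N] contains a copy of [M], in which stopping means going on with [e]. *)
Lemma within_embed M N (f : mstate M -> mstate N) (e : option (mstate N)) :
    (forall s h, mnext (f s) h =
       (if (mnext s h).1 is Some s' then Some (f s') else e, (mnext s h).2)) ->
  forall T s m m', within T (Some s, m) (None : option (mstate M), m') ->
    within T (Some (f s), m) (e, m').
Proof.
move=> fP T s m m' [k]; elim: k T s m => [|k IH] T s m // lekT.
rewrite iterSr {2}/mstep /=; set r := mnext s (heads m) => Hk.
have [T' defT lekT'] : exists2 T', T = 1 + T' & k <= T'.
  by case: T lekT => // T'; exists T'.
rewrite {}defT; case defr: r.1 Hk => [s'|] Hk.
  apply: (within_trans (within_step _) (IH _ _ _ lekT' Hk)).
  by rewrite /mstep /= fP -/r defr.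
(* [M] stops here and its remaining [k] steps change nothing, so one step of [N] suffices. *)
exists 1 => //=; move: Hk; rewrite mstep_None => -[<-].
by rewrite /mstep /= fP -/r defr.
Qed.

Definition act (i : nat) (f : quad cell -> cell) (d : move) : mach :=
  @Mach unit tt (fun _ h => (None, set (idle h) i (f h, d))).

Lemma runs_act i f d m :
  runs (act i f d) 1 m (set m i (update (get m i) (f (heads m), d))).
Proof. by apply: within_step; rewrite /mstep /= update_set_idle. Qed.

(** The last transition of [M] leads directly to the start of [N], so the passage costs no step and
    the times simply add up. *)
Definition mseq (M N : mach) : mach :=
  @Mach (mstate M + mstate N)%type (inl (mstart M))
    (fun s h => match s with
     | inl s => let r := mnext s h in
         (Some (if r.1 is Some s' then inl s' else inr (mstart N)), r.2)
     | inr s => let r := mnext s h in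
         (if r.1 is Some s' then Some (inr s') else None, r.2)
     end).

Lemma runs_seq M N T1 T2 m1 m2 m3 :
  runs M T1 m1 m2 -> runs N T2 m2 m3 -> runs (mseq M N) (T1 + T2) m1 m3.
Proof.
move=> HM HN; apply: (@within_trans (mseq M N) _ _ _ (Some (inr (mstart N)), m2)).
  apply: (@within_embed M (mseq M N) inl) HM => s h /=.
  by case: (mnext s h).1.
exact: (@within_embed N (mseq M N) inr None) HN.
Qed.

Definition mif (b : quad cell -> bool) (M : mach) : mach :=
  @Mach (option (mstate M)) None
    (fun s h => match s with
     | None => (if b h then Some (Some (mstart M)) else None, idle h)
     | Some s => let r := mnext s h in
         (if r.1 is Some s' then Some (Some s') else None, r.2)
     end).

Lemma runs_if_true (b : quad cell -> bool) M T m m' :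
  b (heads m) -> runs M T m m' -> runs (mif b M) (1 + T) m m'.
Proof.
move=> bm HM; apply: (@within_trans (mif b M) _ _ _ (Some (Some (mstart M)), m)).
  by apply: within_step; rewrite /mstep /= bm update_idle.
exact: (@within_embed M (mif b M) Some None) HM.
Qed.

(** Any positive bound is allowed, so that both outcomes of a test can share one. *)
Lemma runs_if_false (b : quad cell -> bool) M T m :
  ~~ b (heads m) -> runs (mif b M) T.+1 m m.
Proof.
move=> /negPf bm; apply: (@within_weaken _ 1) => //.
by apply: within_step; rewrite /mstep /= bm update_idle.
Qed.

Definition mwhile (b : quad cell -> bool) (M : mach) : mach :=
  @Mach (option (mstate M)) None
    (fun s h => match s with
     | None => (if b h then Some (Some (mstart M)) else None, idle h)
     | Some s => let r := mnext s h in
         (Some (if r.1 is Some s' then Some s' else None), r.2)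
     end).

Lemma runs_while_false (b : quad cell -> bool) M m :
  ~~ b (heads m) -> runs (mwhile b M) 1 m m.
Proof.
by move=> /negPf bm; apply: within_step; rewrite /mstep /= bm update_idle.
Qed.

Lemma runs_while_true (b : quad cell -> bool) M T T' m m' m'' :
  b (heads m) -> runs M T m m' -> runs (mwhile b M) T' m' m'' ->
  runs (mwhile b M) (1 + T + T') m m''.
Proof.
move=> bm HM HW; apply: within_trans HW.
apply: (@within_trans (mwhile b M) _ _ _ (Some (Some (mstart M)), m)).
  by apply: within_step; rewrite /mstep /= bm update_idle.
apply: (@within_embed M (mwhile b M) Some (Some None)) HM => s h /=.
by case: (mnext s h).1.
Qed.

(* [m s1 s2] is the memory when the entries of [s1] have been treated and those
   of [s2] have not. *)
Lemma runs_for (A : Type) (b : quad cell -> bool) M T (m : seq A -> seq A -> memory)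
    (s : seq A) :
    (forall s1 x s2, s = s1 ++ x :: s2 ->
       b (heads (m s1 (x :: s2))) /\ runs M T (m s1 (x :: s2)) (m (rcons s1 x) s2)) ->
    ~~ b (heads (m s [::])) ->
  runs (mwhile b M) (size s * T.+1 + 1) (m [::] s) (m s [::]).
Proof.
move=> Hbody Hend.
suff H s2 : forall s1, s = s1 ++ s2 ->
    runs (mwhile b M) (size s2 * T.+1 + 1) (m s1 s2) (m s [::]) by exact: H.
elim: s2 => [|x s2 IH] s1 defs.
  by rewrite defs cats0 in Hend *; apply: runs_while_false.
have [bm HM] := Hbody _ _ _ defs; rewrite /= mulSn -addnA -addn1 [T + 1]addnC.
by apply: (runs_while_true bm HM); apply: IH; rewrite cat_rcons.
Qed.

Definition tm_of_mach (M : mach) : tm S :=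
  @TM S 3 (option (mstate M)) void (Some (mstart M)) (fun s => s == None)
    (fun s h =>
       let q := Quad (h (inord 0)) (h (inord 1)) (h (inord 2)) (h (inord 3)) in
       let r := if s is Some s then mnext s q else (None, idle q) in
       (r.1, [ffun i : 'I_4 => get r.2 i])).

Lemma runs_computes M T w m v :
  runs M T (Quad (word_tape void w) (blank_tape S void) (blank_tape S void)
              (blank_tape S void)) m ->
  tape_word (tape3 m) = v ->
  computes_within (tm_of_mach M) w T v.
Proof.
pose conf (c : option (mstate M) * memory) : config (tm_of_mach M) :=
  @Config S (tm_of_mach M) c.1 [ffun i : 'I_4 => get c.2 i].
have stepP c : step (conf c) = conf (mstep c).
  case: c => [[s|] m'] //; rewrite /step /halted /= /conf /=.
  set q := Quad _ _ _ _; have -> : q = heads m'.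
    by rewrite /q !ffunE !inordK.
  congr Config; apply/ffunP => i; rewrite !ffunE.
  by case: i => [[|[|[|[]]]]].
have iterP k c : iter k (@step _ (tm_of_mach M)) (conf c) = conf (iter k (@mstep M) c).
  by elim: k => //= k ->; rewrite stepP.
case=> k lekT Hk <-; rewrite /computes_within.
have -> : init (tm_of_mach M) w = conf (Some (mstart M),
    Quad (word_tape void w) (blank_tape S void) (blank_tape S void) (blank_tape S void)).
  by congr Config; apply/ffunP => i; rewrite !ffunE; case: i => [[|[|[|[]]]]].
(* [computes_within] performs exactly [T] steps; those after the first [k] leave the stopped machine
   as it is. *)
rewrite -(subnK lekT) iterD iterP Hk iterP mstep_None /halted /= eqxx.
by rewrite /output /conf /= ffunE.
Qed.

End Machines.

(** * Head movements *)

Section Scanning.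
Variable S : finType.

Local Notation cell := (cell S void).
Local Notation tape := (tape S void).
Local Notation memory := (quad tape).
Local Notation mach := (mach S).
Implicit Types (l r s : seq cell) (D : pred cell) (m : memory) (i : nat).

(* [l] lists the cells to the left of the head, nearest first, and [r] the
   scanned cell and those to its right; [zipper l [::]] and
   [zipper l [:: None]] are convertible. *)
Definition zipper l r : tape := Tape l (head None r) (behead r).

Definition mv i (d : move) : mach := act i (fun h => get h i) d.

Definition scan i D d : mach := mwhile (fun h => ~~ D (get h i)) (mv i d).

Definition skip i D : mach := mseq (scan i D MoveRight) (mv i MoveRight).

(* Goes back to just after the nearest cell in [D] strictly to the left. *)
Definition rewind i D : mach :=
  mseq (mv i MoveLeft) (mseq (scan i D MoveLeft) (mv i MoveRight)).

Lemma runs_mv m i d : runs (mv i d) 1 m (set m i (move_head (get m i) d)).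
Proof.
have := runs_act i (fun h => get h i) d m.
by rewrite /update /heads get_map /=; case: (get m i).
Qed.

Lemma runs_right m i l a r : get m i = zipper l (a :: r) ->
  runs (mv i MoveRight) 1 m (set m i (zipper (a :: l) r)).
Proof. by move=> mi; have := runs_mv m i MoveRight; rewrite mi. Qed.

Lemma runs_left m i l a b r : get m i = zipper (a :: l) (b :: r) ->
  runs (mv i MoveLeft) 1 m (set m i (zipper l [:: a, b & r])).
Proof. by move=> mi; have := runs_mv m i MoveLeft; rewrite mi. Qed.

Lemma runs_scan_right m i D l s r :
  get m i = zipper l (s ++ r) -> all (predC D) s -> D (head None r) ->
  runs (scan i D MoveRight) (2 * size s + 1) m (set m i (zipper (catrev s l) r)).
Proof.
move=> mi Ds Dr; elim: s m l mi Ds => [|a s IH] m l mi /=.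
  move=> _; rewrite -mi set_get; apply: runs_while_false.
  by rewrite /heads get_map mi Dr.
case/andP=> Da Ds; rewrite mulnS -addnA.
apply: (runs_while_true _ (runs_right mi)).
  by rewrite /heads get_map mi.
have := IH (set m i (zipper (a :: l) (s ++ r))) (a :: l).
by rewrite get_set set_set; apply.
Qed.

Lemma runs_scan_left m i D l s b x r :
  get m i = zipper (s ++ b :: l) (x :: r) -> ~~ D x -> all (predC D) s -> D b ->
  runs (scan i D MoveLeft) (2 * size s + 3) m
    (set m i (zipper l (b :: catrev s (x :: r)))).
Proof.
move=> mi Dx Ds Db; elim: s m x r mi Dx Ds => [|a s IH] m x r mi Dx /=.
  move=> _; apply: (runs_while_true (T' := 1) _ (runs_left mi)).
    by rewrite /heads get_map mi.
  by apply: runs_while_false; rewrite /heads get_map get_set negbK.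
case/andP=> Da Ds; rewrite mulnS -addnA.
apply: (runs_while_true _ (runs_left mi)).
  by rewrite /heads get_map mi.
have := IH (set m i (zipper (s ++ b :: l) [:: a, x & r])) a (x :: r).
by rewrite get_set set_set; apply.
Qed.

Lemma runs_skip m i D l s a r :
  get m i = zipper l (s ++ a :: r) -> all (predC D) s -> D a ->
  runs (skip i D) (2 * size s + 2) m (set m i (zipper (a :: catrev s l) r)).
Proof.
move=> mi Ds Da; rewrite (addnA _ 1 1).
apply: (runs_seq (runs_scan_right mi Ds Da)).
rewrite -[X in runs _ _ _ X](set_set m i (zipper (catrev s l) (a :: r))).
by apply: runs_right; rewrite get_set.
Qed.

(** The scanned cell has to be listed in [r]: on leaving an unlisted blank the tape records it, and
    the final list could end in an extra [None]. This is why tapes that are rewound from their right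
    end are written with [[:: None]]. *)
Lemma runs_rewind m i D l s b r : r != [::] ->
  get m i = zipper (s ++ b :: l) r -> all (predC D) s -> D b ->
  runs (rewind i D) (2 * size s + 3) m (set m i (zipper (b :: l) (catrev s r))).
Proof.
case: r => // x r _ mi Ds Db.
(* The first move may already reach [b], and then the scan stops at once; otherwise it lands in [s]
   and [runs_scan_left] applies. *)
suff [T ltT [m' [mm' Hm']]] : exists2 T, T <= 2 * size s + 1 & exists m',
    runs (mv i MoveLeft) 1 m m' /\
    runs (scan i D MoveLeft) T m' (set m i (zipper l (b :: catrev s (x :: r)))).
  apply: (@runs_weaken _ _ (1 + (T + 1))); first by lia.
  apply: (runs_seq mm' (runs_seq Hm' _)).
  rewrite -[X in runs _ _ _ X](set_set m i (zipper l (b :: catrev s (x :: r)))).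
  by apply: runs_right; rewrite get_set.
case: s mi Ds => [|a s] /= mi.
  move=> _; exists 1 => //; exists (set m i (zipper l [:: b, x & r])).
  split; first exact: runs_left.
  by apply: runs_while_false; rewrite /heads get_map get_set negbK.
case/andP=> Da Ds; exists (2 * size s + 3); first by lia.
exists (set m i (zipper (s ++ b :: l) [:: a, x & r])).
split; first exact: runs_left.
rewrite -[X in runs _ _ _ X](set_set m i (zipper (s ++ b :: l) [:: a, x & r])).
by apply: runs_scan_left; rewrite ?get_set.
Qed.

End Scanning.

(** * Deciding eligibility of the base relation *)

Local Notation cell := (cell symbol void).
Local Notation word := (seq symbol).
Local Notation entry := (word * word)%type.

Definition sym (a : symbol) : cell := Some (inl a).
Definition syms (w : word) : seq cell := [seq sym a | a <- w].

Definition is_digit (a : symbol) : bool := (a == Zero) || (a == One).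
Definition digit_cell (a : cell) : bool := (a == sym Zero) || (a == sym One).

Definition is_bar (a : cell) : bool := a == sym Bar.
Definition is_semicolon (a : cell) : bool := a == sym Semicolon.
Definition is_delimiter (a : cell) : bool := is_semicolon a || is_bar a.
Definition is_blank (a : cell) : bool := a == None.

Lemma digit_sym a : digit_cell (sym a) = is_digit a.
Proof. by case: a. Qed.

Lemma syms_cat u v : syms (u ++ v) = syms u ++ syms v.
Proof. exact: map_cat. Qed.

Lemma size_syms w : size (syms w) = size w.
Proof. exact: size_map. Qed.

Lemma all_syms (D : pred cell) (w : word) :
  all D (syms w) = all (fun a => D (sym a)) w.
Proof. exact: all_map. Qed.

(* Compares two words of digits; they are equal iff both heads end up on
   symbols that are not digits. *)
Definition compare i j : mach symbol :=
  mwhile (fun h => digit_cell (get h i) && (get h i == get h j))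
    (mseq (mv symbol i MoveRight) (mv symbol j MoveRight)).

(** The loop stops after the longest common prefix [w]; if the words differ there, at least one head
    still faces a digit. The terminators [a] and [b] may be different symbols or the same one, since
    only digits keep the loop going. *)
Lemma runs_compare i j m l l' (u v : word) a b r r' :
    i < 4 -> j < 4 -> i != j ->
    all is_digit u -> all is_digit v -> ~~ is_digit a -> ~~ is_digit b ->
    get m i = zipper l (syms u ++ sym a :: r) ->
    get m j = zipper l' (syms v ++ sym b :: r') ->
  exists w u' v', [/\ u = w ++ u', v = w ++ v', u = v -> u' = [::] /\ v' = [::],
    ~~ digit_cell (head None (syms u' ++ sym a :: r)) &&
    ~~ digit_cell (head None (syms v' ++ sym b :: r')) = (u == v) &
    runs (compare i j) (3 * size u + 1) m
      (set (set m i (zipper (catrev (syms w) l) (syms u' ++ sym a :: r)))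
         j (zipper (catrev (syms w) l') (syms v' ++ sym b :: r')))].
Proof.
move=> lti ltj neij; elim: u v m l l' => [|x u IH] [|y v] m l l' du dv da db mi mj.
- exists [::], [::], [::]; rewrite /= !digit_sym da db; split => //.
  rewrite -mi set_get -mj set_get; apply: runs_while_false.
  by rewrite /heads !get_map mi digit_sym (negPf da).
- exists [::], [::], (y :: v); rewrite /= !digit_sym; split => //.
    by case/andP: dv => ->; rewrite andbF.
  rewrite -[zipper l _]mi set_get -[zipper l' _]mj set_get.
  apply: runs_while_false.
  by rewrite /heads !get_map mi digit_sym (negPf da).
- exists [::], (x :: u), [::]; rewrite /= !digit_sym; split => //.
    by case/andP: du => ->.
  rewrite -[zipper l _]mi set_get -[zipper l' _]mj set_get mulnS.
  apply: (@runs_weaken _ _ 1); first by lia.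
  apply: runs_while_false; rewrite /heads !get_map mi mj /=.
  rewrite negb_and; apply/orP; right; apply: contra db => /eqP [<-].
  by case/andP: du.
case/andP: du => dx du; case/andP: dv => dy dv.
have [eqxy|nexy] := eqVneq x y; last first.
  exists [::], (x :: u), (y :: v); split=> //.
  - by case=> exy; rewrite exy eqxx in nexy.
  - by rewrite /= !digit_sym dx eqseq_cons (negPf nexy).
  rewrite -[zipper l _]mi set_get -[zipper l' _]mj set_get mulnS.
  apply: (@runs_weaken _ _ 1); first by lia.
  apply: runs_while_false; rewrite /heads !get_map mi mj /=.
  by rewrite negb_and; apply/orP; right; apply: contra nexy => /eqP [->].
rewrite -{y}eqxy in dy mj *.
pose m' := set (set m i (zipper (sym x :: l) (syms u ++ sym a :: r)))
  j (zipper (sym x :: l') (syms v ++ sym b :: r')).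
have m'i : get m' i = zipper (sym x :: l) (syms u ++ sym a :: r).
  by rewrite get_set_neq ?get_set // eq_sym.
have m'j : get m' j = zipper (sym x :: l') (syms v ++ sym b :: r').
  by rewrite get_set.
have [w [u' [v' [-> -> Huv Heq Hrun]]]] := IH _ _ _ _ du dv da db m'i m'j.
exists (x :: w), u', v'; split=> //.
- by case=> /Huv.
- by rewrite Heq eqseq_cons eqxx.
have -> : 3 * size (x :: (w ++ u')) + 1 = 1 + (1 + 1) + (3 * size (w ++ u') + 1).
  by rewrite /=; lia.
apply: (@runs_while_true _ _ _ _ _ _ m').
- by rewrite /heads !get_map mi mj digit_sym dx eqxx.
- by apply: runs_seq (runs_right mi) _; apply: runs_right; rewrite get_set_neq.
move: Hrun; congr runs.
rewrite /m'; move: lti ltj neij.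
by case: (i) (j) => [|[|[|[|?]]]] [|[|[|[|?]]]].
Qed.

(** * Matching a constraint with two entries *)

Definition encode_entry (x : entry) : word := x.1 ++ Comma :: x.2.
Definition digits (x : entry) : bool := all is_digit x.1 && all is_digit x.2.

(* [c], [p] and [q] stand for (r1, r2), (u, r) and (u', r'). *)
Definition matches (c p q : entry) : bool :=
  [&& p.1 == q.1, p.2 == c.1 & q.2 == c.2].

Definition apart i j (h : quad cell) : bool :=
  ~~ digit_cell (get h i) && ~~ digit_cell (get h j).

(** A violation recorded by an earlier constraint must survive. *)
Definition flag_found (h : quad cell) : cell :=
  if get h 3 == sym Zero then sym Zero else sym One.

(** The order avoids going back: comparing the users leaves tapes 1 and 2 on their resources, and
    comparing the resource on tape 1 with the first one on tape 0 leaves tape 0 at the end of that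
    one, ready for the second. *)
Definition match_entries : mach symbol :=
  mseq (compare 1 2) (mif (apart 1 2)
    (mseq (mv symbol 1 MoveRight) (mseq (mv symbol 2 MoveRight)
    (mseq (compare 1 0) (mif (apart 1 0)
      (mseq (mv symbol 0 MoveRight)
      (mseq (compare 2 0) (mif (apart 2 0) (act 3 flag_found Stay))))))))).

(* The head is somewhere on the entry [e], which starts to the right of [l], or
   on the semicolon that ends it. *)
Definition inside (l : seq cell) (e : word) (r : seq cell)
    (t : tape symbol void) : Prop :=
  exists x y, e = x ++ y /\
    t = zipper (catrev (syms x) l) (syms y ++ sym Semicolon :: r).

Lemma inside_fst l (w u v : word) r :
  inside l (encode_entry (w ++ u, v)) r
    (zipper (catrev (syms w) l)
       (syms u ++ sym Comma :: syms v ++ sym Semicolon :: r)).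
Proof.
by exists w, (u ++ Comma :: v); rewrite /encode_entry syms_cat -!catA.
Qed.

Lemma inside_snd l (u w v : word) r :
  inside l (encode_entry (u, w ++ v)) r
    (zipper (catrev (syms w) (sym Comma :: catrev (syms u) l))
       (syms v ++ sym Semicolon :: r)).
Proof.
exists (u ++ Comma :: w), v; rewrite /encode_entry -!catA; split=> //.
by rewrite syms_cat !catrevE rev_cat /= rev_cons -cats1 -!catA.
Qed.

Lemma inside_start l e r :
  inside l (encode_entry e) r
    (zipper l (syms (encode_entry e) ++ sym Semicolon :: r)).
Proof. by exists [::], (encode_entry e). Qed.

(** Where the heads stop depends on the first mismatch; [inside] forgets the exact place and still
    allows the later rewinds and skips. *)
Lemma runs_match_entries c p q l0 l1 l2 r0 r1 r2 l3 a :
    digits c -> digits p -> digits q ->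
  exists t0 t1 t2, [/\ inside l0 (encode_entry c) r0 t0,
    inside l1 (encode_entry p) r1 t1, inside l2 (encode_entry q) r2 t2 &
    runs match_entries
      (6 * size (encode_entry p) + 3 * size (encode_entry q) + 10)
      (Quad (zipper l0 (syms (encode_entry c) ++ sym Semicolon :: r0))
         (zipper l1 (syms (encode_entry p) ++ sym Semicolon :: r1))
         (zipper l2 (syms (encode_entry q) ++ sym Semicolon :: r2))
         (zipper l3 [:: a]))
      (Quad t0 t1 t2 (zipper l3 [:: if matches c p q then
         if a == sym Zero then sym Zero else sym One else a]))].
Proof.
case: c p q => [c1 c2] [p1 p2] [q1 q2].
move=> /andP[/= dc1 dc2] /andP[/= dp1 dp2] /andP[/= dq1 dq2].
have eE (u v : word) r : syms (encode_entry (u, v)) ++ r =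
    syms u ++ sym Comma :: syms v ++ r.
  by rewrite /encode_entry syms_cat -catA.
rewrite !eE /matches /=.
have szE (u v : word) : size (encode_entry (u, v)) = size u + size v + 1.
  by rewrite /encode_entry size_cat /=; lia.
rewrite !szE.
have [w [u [v [defp defq Huv Heq]]]] := @runs_compare 1 2
  (Quad (zipper l0 (syms c1 ++ sym Comma :: syms c2 ++ sym Semicolon :: r0))
     (zipper l1 (syms p1 ++ sym Comma :: syms p2 ++ sym Semicolon :: r1))
     (zipper l2 (syms q1 ++ sym Comma :: syms q2 ++ sym Semicolon :: r2))
     (zipper l3 [:: a])) _ _ p1 q1 Comma Comma
  _ _ isT isT isT dp1 dq1 isT isT erefl erefl.
rewrite [set _ _ _]/= => Hrun1.
have [Epq|nepq] := eqVneq p1 q1; last first.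
  do 3!eexists; split; last first.
  - apply: (@runs_weaken _ _ (3 * size p1 + 1 + 1)); first by clear; lia.
    apply: runs_seq Hrun1 (runs_if_false _ _ _).
    by rewrite /apart [get _ 1]/= [get _ 2]/= Heq.
  - by rewrite defq; apply: inside_fst.
  - by rewrite defp; apply: inside_fst.
  by rewrite -eE; apply: inside_start.
have [u0 v0] := Huv Epq; subst u v; move: defp Heq Hrun1.
rewrite !cats0 => <- {w Huv defq} Heq Hrun1.
have [w [u [v [defp defc Huv Heq2]]]] := @runs_compare 1 0
  (Quad (zipper l0 (syms c1 ++ sym Comma :: syms c2 ++ sym Semicolon :: r0))
     (zipper (sym Comma :: catrev (syms p1) l1) (syms p2 ++ sym Semicolon :: r1))
     (zipper (sym Comma :: catrev (syms p1) l2) (syms q2 ++ sym Semicolon :: r2))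
     (zipper l3 [:: a])) _ _ p2 c1 Semicolon Comma
  _ _ isT isT isT dp2 dc1 isT isT erefl erefl.
rewrite [set _ _ _]/= => Hrun2.
rewrite -Epq in Heq Hrun1 *.
have [Epc|nepc] := eqVneq p2 c1; last first.
  do 3!eexists; split; last first.
  - apply: (@runs_weaken _ _ (3 * size p1 + 1 +
      (1 + (1 + (1 + (3 * size p2 + 1 + 1)))))); first by clear; lia.
    apply: (runs_seq Hrun1 (runs_if_true _ _)).
      by rewrite /apart [get _ 1]/= [get _ 2]/= Heq eqxx.
    apply: runs_seq; first by apply: runs_right; reflexivity.
    rewrite [set _ _ _]/=.
    apply: runs_seq; first by apply: runs_right; reflexivity.
    rewrite [set _ _ _]/=.
    apply: runs_seq Hrun2 (runs_if_false _ _ _).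
    by rewrite /apart [get _ 1]/= [get _ 0]/= Heq2.
  - by rewrite -[q2]cat0s; apply: inside_snd.
  - by rewrite defp; apply: inside_snd.
  by rewrite defc; apply: inside_fst.
have [u0 v0] := Huv Epc; subst u v; move: defp Heq2 Hrun2.
rewrite !cats0 => <- {w Huv defc} Heq2 Hrun2.
have [w [u [v [defq defc Huv Heq3]]]] := @runs_compare 2 0
  (Quad (zipper (sym Comma :: catrev (syms p2) l0) (syms c2 ++ sym Semicolon :: r0))
     (zipper (catrev (syms p2) (sym Comma :: catrev (syms p1) l1)) (sym Semicolon :: r1))
     (zipper (sym Comma :: catrev (syms p1) l2) (syms q2 ++ sym Semicolon :: r2))
     (zipper l3 [:: a])) _ _ q2 c2 Semicolon Semicolon
  _ _ isT isT isT dq2 dc2 isT isT erefl erefl.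
rewrite [set _ _ _]/= => Hrun3.
rewrite -Epc in Heq2 Hrun1 Hrun2 *.
(* The last test affects only the flag, so its two outcomes share the rest of the run. *)
suff Hrun4 : runs (mif (apart 2 0) (act 3 flag_found Stay)) 2
    (Quad (zipper (catrev (syms w) (sym Comma :: catrev (syms p2) l0))
         (syms v ++ sym Semicolon :: r0))
       (zipper (catrev (syms p2) (sym Comma :: catrev (syms p1) l1))
         (sym Semicolon :: r1))
       (zipper (catrev (syms w) (sym Comma :: catrev (syms p1) l2))
         (syms u ++ sym Semicolon :: r2)) (zipper l3 [:: a]))
    (Quad (zipper (catrev (syms w) (sym Comma :: catrev (syms p2) l0))
         (syms v ++ sym Semicolon :: r0))
       (zipper (catrev (syms p2) (sym Comma :: catrev (syms p1) l1))
         (sym Semicolon :: r1))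
       (zipper (catrev (syms w) (sym Comma :: catrev (syms p1) l2))
         (syms u ++ sym Semicolon :: r2)) (zipper l3 [:: if q2 == c2 then
         if a == sym Zero then sym Zero else sym One else a])).
  do 3!eexists; split; last first.
  - apply: (@runs_weaken _ _ (3 * size p1 + 1 +
      (1 + (1 + (1 + (3 * size p2 + 1 + (1 + (1 + (3 * size q2 + 1 + 2))))))))).
      by clear; lia.
    apply: (runs_seq Hrun1 (runs_if_true _ _)).
      by rewrite /apart [get _ 1]/= [get _ 2]/= Heq eqxx.
    apply: runs_seq; first by apply: runs_right; reflexivity.
    rewrite [set _ _ _]/=.
    apply: runs_seq; first by apply: runs_right; reflexivity.
    rewrite [set _ _ _]/=.
    apply: (runs_seq Hrun2 (runs_if_true _ _)).
      by rewrite /apart [get _ 1]/= [get _ 0]/= Heq2 eqxx.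
    apply: runs_seq; first by apply: runs_right; reflexivity.
    by apply: runs_seq Hrun3 Hrun4.
  - by rewrite defq; apply: inside_snd.
  - by have := inside_snd l1 p1 p2 [::] r1; rewrite cats0.
  by rewrite defc; apply: inside_snd.
case: eqP Heq3 => [_|_] Heq3; last first.
  by apply: runs_if_false; rewrite /apart [get _ 2]/= [get _ 0]/= Heq3.
apply: (runs_if_true _ (runs_act 3 flag_found Stay _)).
by rewrite /apart [get _ 2]/= [get _ 0]/= Heq3.
Qed.

(** * Lists of entries on a tape *)

Definition encode_entries : seq entry -> word := encode_list encode_entry.

Lemma encode_entries_cons x es :
  encode_entries (x :: es) = encode_entry x ++ Semicolon :: encode_entries es.
Proof. by rewrite /encode_entries /encode_list /= cat_rcons. Qed.

Lemma encode_entries_cat es1 es2 :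
  encode_entries (es1 ++ es2) = encode_entries es1 ++ encode_entries es2.
Proof. by rewrite /encode_entries /encode_list map_cat flatten_cat. Qed.

Lemma size_encode_entry ds x :
  x \in ds -> size (encode_entry x) <= size (encode_entries ds).
Proof.
elim: ds => // y ds IH; rewrite encode_entries_cons size_cat inE /=.
by case/predU1P=> [->|/IH]; lia.
Qed.

Lemma size_entries ds : size ds <= size (encode_entries ds).
Proof.
by elim: ds => // y ds IH; rewrite encode_entries_cons size_cat /=; lia.
Qed.

(* The cells to the left of the head when [es] has been read, nearest first. *)
Definition passed (l : seq cell) (es : seq entry) : seq cell :=
  catrev (syms (encode_entries es)) (sym Bar :: l).

(** The shape of a tape in the loop invariants; the [Bar] inside [passed] is where a rewind of the
    whole list stops. *)
Definition between l es1 es2 r : tape symbol void :=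
  zipper (passed l es1) (syms (encode_entries es2) ++ r).

Lemma between_cons l es1 x es2 r :
  between l es1 (x :: es2) r = zipper (passed l es1)
    (syms (encode_entry x) ++ sym Semicolon :: syms (encode_entries es2) ++ r).
Proof. by rewrite /between encode_entries_cons syms_cat -catA. Qed.

Lemma between_rcons l es1 x es2 r :
  between l (rcons es1 x) es2 r =
  zipper (sym Semicolon :: catrev (syms (encode_entry x)) (passed l es1))
    (syms (encode_entries es2) ++ r).
Proof.
rewrite /between /passed -cats1 encode_entries_cat encode_entries_cons syms_cat.
by rewrite syms_cat !catrevE !rev_cat rev_cons -cats1 /= -!catA.
Qed.

(** Rewinding a single entry needs a cell to stop at: the [Semicolon] of the preceding entry or, for
    the first entry, the [Bar]. *)
Lemma passed_delimiter l es :
  exists b l', passed l es = b :: l' /\ is_delimiter b.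
Proof.
case/lastP: es => [|es x]; first by exists (sym Bar), l.
(* With nothing to the right, the left lists can be read off from [between_rcons] by injectivity. *)
have [->] : between l (rcons es x) [::] [::] = zipper
  (sym Semicolon :: catrev (syms (encode_entry x)) (passed l es)) [::].
  exact: between_rcons.
by exists (sym Semicolon); eexists; split.
Qed.

Lemma digits_encode_entry (D : pred cell) x :
    digits x -> ~~ D (sym Zero) -> ~~ D (sym One) -> ~~ D (sym Comma) ->
  all (predC D) (syms (encode_entry x)).
Proof.
case/andP=> d1 d2 D0 D1 DC; rewrite all_syms all_cat /= DC.
have sub a : is_digit a -> ~~ D (sym a) by case: a.
by rewrite (sub_all sub d1) (sub_all sub d2).
Qed.

Lemma digits_encode_entries es :
  all digits es -> all (predC is_bar) (syms (encode_entries es)).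
Proof.
elim: es => //= x es IH /andP[dx des]; rewrite encode_entries_cons syms_cat.
by rewrite all_cat /= IH // digits_encode_entry.
Qed.

Lemma runs_rewind_inside m i b l x r :
    inside (b :: l) (encode_entry x) r (get m i) -> is_delimiter b -> digits x ->
  runs (rewind i is_delimiter) (2 * size (encode_entry x) + 3) m
    (set m i (zipper (b :: l) (syms (encode_entry x) ++ sym Semicolon :: r))).
Proof.
move=> [u [v [defx mi]]] Db dx.
have := @digits_encode_entry is_delimiter x dx isT isT isT.
rewrite defx syms_cat all_cat => /andP[Du _].
rewrite -[syms u]revK -catA -catrevE.
apply: (@runs_weaken _ _ (2 * size (rev (syms u)) + 3)).
  by rewrite size_rev size_syms size_cat leq_add2r leq_mul2l leq_addr.
apply: runs_rewind; rewrite ?all_rev //; first by case: (syms v).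
by rewrite mi catrevE.
Qed.

Lemma runs_skip_inside m i l x r :
    inside l (encode_entry x) r (get m i) -> digits x ->
  runs (skip i is_semicolon) (2 * size (encode_entry x) + 2) m
    (set m i (zipper (sym Semicolon :: catrev (syms (encode_entry x)) l) r)).
Proof.
move=> [u [v [defx mi]]] dx.
have := @digits_encode_entry is_semicolon x dx isT isT isT.
rewrite defx syms_cat all_cat => /andP[_ Dv].
rewrite catrev_catl.
apply: (@runs_weaken _ _ (2 * size (syms v) + 2)).
  by rewrite size_syms size_cat leq_add2r leq_mul2l leq_addl.
exact: runs_skip.
Qed.

Lemma runs_rewind_entries m i l es :
    get m i = between l es [::] [:: None] -> all digits es ->
  runs (rewind i is_bar) (2 * size (encode_entries es) + 3) m
    (set m i (between l [::] es [:: None])).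
Proof.
move=> mi des; rewrite /between -[syms (encode_entries es)]revK -catrevE.
rewrite -size_syms -size_rev.
apply: runs_rewind; rewrite ?all_rev ?digits_encode_entries //.
by rewrite mi /between /passed catrevE.
Qed.

(* The cell after the output: [Zero] once some constraint has turned out to be
   violated, else [One] if the current one has turned out to be satisfied. *)
Definition flag (bad found : bool) : cell :=
  if bad then sym Zero else if found then sym One else None.

(** * Nested loops over constraints and pairs of entries *)

Definition try_pair : mach symbol :=
  mseq match_entries (mseq (rewind 0 is_delimiter)
    (mseq (rewind 1 is_delimiter) (skip 2 is_semicolon))).

(** Rewinding at the start of a round, here and in [try_constraint], suits [copy_section], which
    leaves the heads behind the copies. *)
Definition try_entry : mach symbol :=
  mseq (rewind 2 is_bar)
    (mseq (mwhile (fun h => ~~ is_blank (get h 2)) try_pair)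
      (skip 1 is_semicolon)).

(** A blank means that no pair matched, hence a new violation; [One] is erased to make room for the
    next constraint. *)
Definition flag_settle (h : quad cell) : cell :=
  if get h 3 == sym One then None else sym Zero.

Definition try_constraint : mach symbol :=
  mseq (rewind 1 is_bar)
    (mseq (mwhile (fun h => ~~ is_blank (get h 1)) try_entry)
      (mseq (act 3 flag_settle Stay) (skip 0 is_semicolon))).

Definition try_constraints : mach symbol :=
  mwhile (fun h => ~~ is_blank (get h 0)) try_constraint.

Lemma flag_update (b bad found : bool) :
  (if b then if flag bad found == sym Zero then sym Zero else sym One
   else flag bad found) = flag bad (b || found).
Proof. by case: b bad found => [] [] []. Qed.

Lemma runs_try_pair N c p q l0 l1 l2 l3 cs1 cs2 es1 es2 fs1 fs2 r0 r1 r2 bad found :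
    digits c -> digits p -> digits q ->
    size (encode_entry c) <= N -> size (encode_entry p) <= N ->
    size (encode_entry q) <= N ->
  runs try_pair (15 * N + 18)
    (Quad (between l0 cs1 (c :: cs2) r0) (between l1 es1 (p :: es2) r1)
       (between l2 fs1 (q :: fs2) r2) (zipper l3 [:: flag bad found]))
    (Quad (between l0 cs1 (c :: cs2) r0) (between l1 es1 (p :: es2) r1)
       (between l2 (rcons fs1 q) fs2 r2)
       (zipper l3 [:: flag bad (matches c p q || found)])).
Proof.
move=> dc dp dq lec lep leq; rewrite !between_cons between_rcons.
have [b0 [l0' [El0 Db0]]] := passed_delimiter l0 cs1.
have [b1 [l1' [El1 Db1]]] := passed_delimiter l1 es1.
rewrite El0 El1.
have [t0 [t1 [t2 [in0 in1 in2 Hmatch]]]] := @runs_match_entries c p q (b0 :: l0')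
  (b1 :: l1') (passed l2 fs1) (syms (encode_entries cs2) ++ r0)
  (syms (encode_entries es2) ++ r1) (syms (encode_entries fs2) ++ r2)
  l3 (flag bad found) dc dp dq.
rewrite flag_update in Hmatch.
apply: (@runs_weaken _ _ (6 * size (encode_entry p) + 3 * size (encode_entry q) + 10 +
  (2 * size (encode_entry c) + 3 + (2 * size (encode_entry p) + 3 +
   (2 * size (encode_entry q) + 2))))).
  by move: lec lep leq; clear; lia.
apply: (runs_seq Hmatch).
apply: runs_seq; first
  by apply: runs_rewind_inside; [exact: in0 | exact: Db0 | exact: dc].
rewrite [set _ _ _]/=.
apply: runs_seq; first
  by apply: runs_rewind_inside; [exact: in1 | exact: Db1 | exact: dp].
rewrite [set _ _ _]/=.
set m := Quad _ _ _ _; exact: (@runs_skip_inside m 2).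
Qed.

(** This makes a blank a safe end marker for the loops: even with an empty first word, an entry
    starts with its [Comma]. *)
Lemma between_not_blank l es1 x es2 r :
  ~~ is_blank (Defs.thead (between l es1 (x :: es2) r)).
Proof. by rewrite between_cons /encode_entry; case: (x) => [[|a u] v]. Qed.

Section Loops.
Variables (N : nat) (es : seq entry).
Hypothesis es_digits : all digits es.
Hypothesis es_size : size (encode_entries es) <= N.

Let entry_size x : x \in es -> size (encode_entry x) <= N.
Proof. by move/size_encode_entry/leq_trans; apply. Qed.

Lemma runs_try_pairs c p l0 l1 l2 l3 cs1 cs2 es1 es2 r0 r1 bad found :
    digits c -> digits p ->
    size (encode_entry c) <= N -> size (encode_entry p) <= N ->
  runs (mwhile (fun h => ~~ is_blank (get h 2)) try_pair) (N * (15 * N + 19) + 1)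
    (Quad (between l0 cs1 (c :: cs2) r0) (between l1 es1 (p :: es2) r1)
       (between l2 [::] es [:: None]) (zipper l3 [:: flag bad found]))
    (Quad (between l0 cs1 (c :: cs2) r0) (between l1 es1 (p :: es2) r1)
       (between l2 es [::] [:: None])
       (zipper l3 [:: flag bad (has (matches c p) es || found)])).
Proof.
move=> dc dp lec lep.
apply: (@runs_weaken _ _ (size es * (15 * N + 18).+1 + 1)).
  by rewrite -addnS leq_add2r leq_mul2r (leq_trans (size_entries _) es_size) orbT.
apply: (@runs_for _ _ _ _ _ (fun s1 s2 =>
  Quad (between l0 cs1 (c :: cs2) r0) (between l1 es1 (p :: es2) r1)
       (between l2 s1 s2 [:: None])
       (zipper l3 [:: flag bad (has (matches c p) s1 || found)]))) => //.
move=> s1 q s2 defs; split; first by rewrite /heads get_map between_not_blank.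
have esq : q \in es by rewrite defs mem_cat mem_head orbT.
rewrite has_rcons -orbA; apply: runs_try_pair => //; last exact: entry_size.
exact: (allP es_digits).
Qed.

Lemma runs_try_entry c p l0 l1 l2 l3 cs1 cs2 es1 es2 r0 r1 bad found :
    digits c -> digits p ->
    size (encode_entry c) <= N -> size (encode_entry p) <= N ->
  runs try_entry (15 * N ^ 2 + 23 * N + 6)
    (Quad (between l0 cs1 (c :: cs2) r0) (between l1 es1 (p :: es2) r1)
       (between l2 es [::] [:: None]) (zipper l3 [:: flag bad found]))
    (Quad (between l0 cs1 (c :: cs2) r0) (between l1 (rcons es1 p) es2 r1)
       (between l2 es [::] [:: None])
       (zipper l3 [:: flag bad (has (matches c p) es || found)])).
Proof.
move=> dc dp lec lep.
apply: (@runs_weaken _ _ (2 * size (encode_entries es) + 3 +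
  (N * (15 * N + 19) + 1 + (2 * size (encode_entry p) + 2)))).
  by move: es_size lep; clear; rewrite -mulnn; lia.
apply: runs_seq; first exact: runs_rewind_entries.
rewrite [set _ _ _]/=; apply: runs_seq; first exact: runs_try_pairs.
rewrite between_rcons.
set m := Quad _ _ _ _; apply: (@runs_skip_inside m 1) => //.
by rewrite /m /= between_cons; apply: inside_start.
Qed.

Definition satisfied (c : entry) : bool :=
  has (fun p => has (matches c p) es) es.

Lemma runs_try_entries c l0 l1 l2 l3 cs1 cs2 r0 bad found :
    digits c -> size (encode_entry c) <= N ->
  runs (mwhile (fun h => ~~ is_blank (get h 1)) try_entry)
    (N * (15 * N ^ 2 + 23 * N + 7) + 1)
    (Quad (between l0 cs1 (c :: cs2) r0) (between l1 [::] es [:: None])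
       (between l2 es [::] [:: None]) (zipper l3 [:: flag bad found]))
    (Quad (between l0 cs1 (c :: cs2) r0) (between l1 es [::] [:: None])
       (between l2 es [::] [:: None])
       (zipper l3 [:: flag bad (satisfied c || found)])).
Proof.
move=> dc lec.
apply: (@runs_weaken _ _ (size es * (15 * N ^ 2 + 23 * N + 6).+1 + 1)).
  by rewrite -addnS leq_add2r leq_mul2r (leq_trans (size_entries _) es_size) orbT.
apply: (@runs_for _ _ _ _ _ (fun s1 s2 =>
  Quad (between l0 cs1 (c :: cs2) r0) (between l1 s1 s2 [:: None])
       (between l2 es [::] [:: None])
       (zipper l3 [:: flag bad (has (fun p => has (matches c p) es) s1 || found)])))
  => //.
move=> s1 p s2 defs; split; first by rewrite /heads get_map between_not_blank.
have esp : p \in es by rewrite defs mem_cat mem_head orbT.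
rewrite has_rcons -orbA; apply: runs_try_entry => //; last exact: entry_size.
exact: (allP es_digits).
Qed.

Lemma runs_try_constraint c l0 l1 l2 l3 cs1 cs2 r0 bad :
    digits c -> size (encode_entry c) <= N ->
  runs try_constraint (15 * N ^ 3 + 23 * N ^ 2 + 11 * N + 7)
    (Quad (between l0 cs1 (c :: cs2) r0) (between l1 es [::] [:: None])
       (between l2 es [::] [:: None]) (zipper l3 [:: flag bad false]))
    (Quad (between l0 (rcons cs1 c) cs2 r0) (between l1 es [::] [:: None])
       (between l2 es [::] [:: None])
       (zipper l3 [:: flag (bad || ~~ satisfied c) false])).
Proof.
move=> dc lec.
apply: (@runs_weaken _ _ (2 * size (encode_entries es) + 3 +
  (N * (15 * N ^ 2 + 23 * N + 7) + 1 + (1 + (2 * size (encode_entry c) + 2))))).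
  by move: es_size lec; clear; rewrite (expnS _ 2) -mulnn; nia.
apply: runs_seq; first exact: runs_rewind_entries.
rewrite [set _ _ _]/=; apply: runs_seq; first exact: runs_try_entries.
apply: runs_seq; first exact: runs_act.
rewrite between_rcons.
set m := (X in runs _ _ X _).
have -> : m = Quad (between l0 cs1 (c :: cs2) r0) (between l1 es [::] [:: None])
    (between l2 es [::] [:: None])
    (zipper l3 [:: flag (bad || ~~ satisfied c) false]).
  by rewrite {}/m; case: bad (satisfied c) => [] [].
set m' := Quad _ _ _ _; apply: (@runs_skip_inside m' 0) => //.
by rewrite /m' /= between_cons; apply: inside_start.
Qed.

Lemma runs_try_constraints cs l0 l1 l2 l3 :
    all digits cs -> size (encode_entries cs) <= N ->
  runs try_constraints (N * (15 * N ^ 3 + 23 * N ^ 2 + 11 * N + 8) + 1)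
    (Quad (between l0 [::] cs [::]) (between l1 es [::] [:: None])
       (between l2 es [::] [:: None]) (zipper l3 [:: None]))
    (Quad (between l0 cs [::] [::]) (between l1 es [::] [:: None])
       (between l2 es [::] [:: None])
       (zipper l3 [:: flag (~~ all satisfied cs) false])).
Proof.
move=> dcs lecs.
apply: (@runs_weaken _ _ (size cs * (15 * N ^ 3 + 23 * N ^ 2 + 11 * N + 7).+1 + 1)).
  by rewrite -addnS leq_add2r leq_mul2r (leq_trans (size_entries _) lecs) orbT.
apply: (@runs_for _ _ _ _ _ (fun s1 s2 =>
  Quad (between l0 s1 s2 [::]) (between l1 es [::] [:: None])
       (between l2 es [::] [:: None])
       (zipper l3 [:: flag (~~ all satisfied s1) false]))) => //.
move=> s1 c s2 defs; split; first by rewrite /heads get_map between_not_blank.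
have csc : c \in cs by rewrite defs mem_cat mem_head orbT.
rewrite all_rcons negb_and orbC; apply: runs_try_constraint.
  exact: (allP dcs).
exact: leq_trans (size_encode_entry csc) lecs.
Qed.

End Loops.

(** * The complete machine and its running time *)

Definition copy_section : mach symbol :=
  mwhile (fun h => ~~ is_bar (get h 0))
    (mseq (act 1 (fun h => get h 0) MoveRight)
    (mseq (act 2 (fun h => get h 0) MoveRight)
    (mseq (act 3 (fun h => get h 0) MoveRight) (mv symbol 0 MoveRight)))).

Lemma runs_copy_section (w : word) l0 l1 l2 l3 r : Bar \notin w ->
  runs copy_section (5 * size w + 1)
    (Quad (zipper l0 (syms w ++ sym Bar :: r)) (zipper l1 [::]) (zipper l2 [::])
       (zipper l3 [::]))
    (Quad (zipper (catrev (syms w) l0) (sym Bar :: r))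
       (zipper (catrev (syms w) l1) [::]) (zipper (catrev (syms w) l2) [::])
       (zipper (catrev (syms w) l3) [::])).
Proof.
elim: w l0 l1 l2 l3 => [|a w IH] l0 l1 l2 l3 /=.
  by move=> _; apply: runs_while_false.
rewrite inE negb_or => /andP[nea /IH{}IH].
rewrite mulnS -addnA; apply: (runs_while_true (T := 4) _ _ (IH _ _ _ _)).
  by rewrite /is_bar /=; apply: contra nea => /eqP[->].
apply: (@runs_seq _ _ _ 1 3); first exact: runs_act.
apply: (@runs_seq _ _ _ 1 2); first exact: runs_act.
apply: (@runs_seq _ _ _ 1 1); first exact: runs_act.
exact: runs_mv.
Qed.

(** The [Bar] on tapes 1 and 2 and the blank first cell on tape 3 are stops for later rewinds; the
    [One] begins the positive answer. *)
Definition decide_base : mach symbol :=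
  mseq (skip 0 is_bar) (mseq (skip 0 is_bar)
  (mseq (act 1 (fun=> sym Bar) MoveRight) (mseq (act 2 (fun=> sym Bar) MoveRight)
  (mseq (act 3 (fun=> None) MoveRight) (mseq (act 3 (fun=> sym One) MoveRight)
  (mseq copy_section (mseq (mv symbol 0 MoveRight) (mseq try_constraints
  (mif (fun h => get h 3 != sym Zero) (rewind 3 is_blank)))))))))).

Lemma no_bar_syms w : Bar \notin w -> all (predC is_bar) (syms w).
Proof.
move=> noBar; rewrite all_syms; apply/allP => a aw /=.
by apply: contra noBar => /eqP[<-].
Qed.

Lemma tape_word_syms l w : tape_word (zipper l (syms w ++ [:: None])) = w.
Proof.
have wP v : word_prefix (syms v ++ [:: None : cell]) = v.
  by elim: v => //= a v ->.
by rewrite -[RHS]wP; case: w.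
Qed.

Lemma no_bar_encode_entries es : all digits es -> Bar \notin encode_entries es.
Proof.
move/digits_encode_entries; rewrite all_syms => /allP noBar.
by apply/negP => /noBar.
Qed.

Lemma runs_decide_base (us rs : word) (es cs : seq entry) :
    Bar \notin us -> Bar \notin rs -> all digits es -> all digits cs ->
  let w :=
    us ++ Bar :: rs ++ Bar :: encode_entries es ++ Bar :: encode_entries cs in
  computes_within (tm_of_mach decide_base) w (100 * size w ^ 4 + 100)
    (if all (satisfied es) cs then One :: encode_entries es else [:: Zero]).
Proof.
move=> usP rsP des dcs w; set N := size w.
have sizew : N = size us + size rs + size (encode_entries es)
    + size (encode_entries cs) + 3.
  by rewrite /N /w size_cat /= size_cat /= size_cat /=; lia.
have leE : size (encode_entries es) <= N by lia.
have leC : size (encode_entries cs) <= N by lia.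
set out := if _ then _ else _.
suff [m [Hrun <-]] : exists m, runs decide_base (100 * N ^ 4 + 100)
    (Quad (word_tape void w) (blank_tape symbol void) (blank_tape symbol void)
      (blank_tape symbol void)) m /\ tape_word (tape3 m) = out.
  exact: runs_computes Hrun _.
have -> : word_tape void w = zipper [::] (syms us ++ sym Bar :: syms rs ++ sym Bar ::
    syms (encode_entries es) ++ sym Bar :: syms (encode_entries cs)).
  rewrite -[LHS]/(zipper [::] (syms w)) /w syms_cat /= syms_cat /=.
  by rewrite (syms_cat (encode_entries es)).
pose l0 := sym Bar :: catrev (syms rs) (sym Bar :: catrev (syms us) [::]).
pose l0' := catrev (syms (encode_entries es)) l0.
pose l3 := catrev (syms (encode_entries es)) [:: sym One; None].
(* Only the final test depends on the answer; the common part of the run is dealt with first. *)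
suff [m [Hrun mout]] : exists m,
    runs (mif (fun h => get h 3 != sym Zero) (rewind 3 is_blank)) (2 * N + 6)
    (Quad (between l0' cs [::] [::]) (between [::] es [::] [:: None])
       (between [::] es [::] [:: None])
       (zipper l3 [:: flag (~~ all (satisfied es) cs) false])) m
    /\ tape_word (tape3 m) = out.
  exists m; split=> //.
  apply: (@runs_weaken _ _ (2 * size (syms us) + 2 + (2 * size (syms rs) + 2 + (1 + (1 + (1 + (1 +
    (5 * size (encode_entries es) + 1 + (1 +
    (N * (15 * N ^ 3 + 23 * N ^ 2 + 11 * N + 8) + 1 + (2 * N + 6))))))))))).
    (* As [N] is positive, every lower power is at most [N ^ 4]. The coefficients then sum to 68 and
       the constants to 17, so 100 is a round bound for both. *)
    have [leU leR N_gt0] : [/\ size us <= N, size rs <= N & 0 < N] by split; lia.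
    have N12 : N <= N ^ 2 by rewrite -{1}(expn1 N) leq_pexp2l.
    have N23 : N ^ 2 <= N ^ 3 by rewrite leq_pexp2l.
    have N34 : N ^ 3 <= N ^ 4 by rewrite leq_pexp2l.
    rewrite !size_syms; have -> : N * (15 * N ^ 3 + 23 * N ^ 2 + 11 * N + 8) =
        15 * N ^ 4 + 23 * N ^ 3 + 11 * N ^ 2 + 8 * N.
      by rewrite !expnS expn0; clear; lia.
    by move: leU leR leE N12 N23 N34; clear; lia.
  apply: runs_seq; first by apply: runs_skip; [reflexivity | exact: no_bar_syms | ].
  rewrite [set _ _ _]/=.
  apply: runs_seq; first by apply: runs_skip; [reflexivity | exact: no_bar_syms | ].
  rewrite [set _ _ _]/=.
  do 4!(apply: runs_seq; first exact: runs_act).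
  apply: runs_seq; first exact: (runs_copy_section _ _ _ _ _ (no_bar_encode_entries des)).
  apply: runs_seq; first by apply: runs_right; reflexivity.
  apply: runs_seq Hrun.
  have := runs_try_constraints des leE l0' [::] [::] l3 dcs leC.
  by rewrite {1}/between cats0.
rewrite /out; case: all; last first.
  eexists; split.
    by apply: (@runs_weaken _ _ 1); [rewrite addnS | apply: runs_if_false].
  by [].
eexists; split.
  apply: (@runs_weaken _ _ (1 + (2 * size (rev (syms (One :: encode_entries es))) + 3))).
    by rewrite size_rev size_syms /=; lia.
  apply: runs_if_true => //.
  apply: (@runs_rewind _ _ _ _ [::] (rev (syms (One :: encode_entries es))) None
    [:: None]) => //.
    by rewrite [get _ 3]/= /l3 catrevE /= rev_cons -cats1 -catA.
  by rewrite all_rev all_syms; apply/allP.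
rewrite [tape3 _]/= catrevE revK; exact: (@tape_word_syms _ (One :: _)).
Qed.

(** * Instances as lists of words *)

(** The default [Zero] makes this exclude the empty word too; it also separates these codes from the
    code of 0. *)
Lemma head_encode_positive p : head Zero (encode_positive p) = One.
Proof. by elim: p => //= p; case: (encode_positive p). Qed.

Lemma encode_positive_inj : injective encode_positive.
Proof.
have neq0 p : encode_positive p != [::].
  by apply/eqP => Ep; have := head_encode_positive p; rewrite Ep.
have neq1 p a : rcons (encode_positive p) a <> [:: One].
  case: (encode_positive p) (neq0 p) => // b s _ [_].
  by case: s.
elim=> [p IH|p IH|] [q|q|] //=;
  first [by case/rcons_inj => /IH-> | by case/rcons_inj | by move/neq1
    | by move/esym/neq1].
Qed.

Lemma encode_nat_inj : injective encode_nat.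
Proof.
move=> m n; rewrite -{2}[m]bin_of_natK -{2}[n]bin_of_natK /encode_nat.
case: (bin_of_nat m) (bin_of_nat n) => [|p] [|q] //.
- by move=> E; have := head_encode_positive q; rewrite -E.
- by move=> E; have := head_encode_positive p; rewrite E.
by move/encode_positive_inj->.
Qed.

Lemma encode_elt_inj (T : finType) : injective (@encode_elt T).
Proof. by move=> x y /encode_nat_inj/val_inj/enum_rank_inj. Qed.

Lemma digits_encode_elt (T : finType) (x : T) : all is_digit (encode_elt x).
Proof.
rewrite /encode_elt /encode_nat; case: bin_of_nat => // p.
by elim: p => //= p IH; rewrite all_rcons.
Qed.

Lemma no_bar_encode_elts (T : finType) (s : seq T) :
  Bar \notin encode_list (@encode_elt T) s.
Proof.
apply/negP => /flattenP[_ /mapP[x _ ->]]; rewrite mem_rcons inE /=.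
by move/(allP (digits_encode_elt x)).
Qed.

Definition entry_of (T T' : finType) (x : T * T') : entry :=
  (encode_elt x.1, encode_elt x.2).

Lemma encode_list_pairs (T T' : finType) (s : seq (T * T')) :
  encode_list (@encode_pair T T') s = encode_entries (map (@entry_of T T') s).
Proof. by rewrite /encode_entries /encode_list -map_comp. Qed.

Lemma digits_entries (T T' : finType) (s : seq (T * T')) :
  all digits (map (@entry_of T T') s).
Proof.
by rewrite all_map; apply/allP => x _; rewrite /= /digits !digits_encode_elt.
Qed.

(** Names are injective, so equal words mean equal elements, and a matching pair of entries is a
    user authorized for both resources. *)
Lemma satisfied_entries (U R : finType) (A : {set U * R}) (c : R * R) :
  satisfied (map (@entry_of U R) (enum A)) (entry_of c) =
  (authorized_users A c.1 :&: authorized_users A c.2 != set0).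
Proof.
rewrite /satisfied has_map; apply/hasP/set0Pn.
  case=> -[u r]; rewrite mem_enum /= has_map => pA /hasP[[u' r']].
  rewrite mem_enum /= => qA /and3P[/= /eqP/encode_elt_inj Eu].
  move=> /eqP/encode_elt_inj Er /eqP/encode_elt_inj Er'; subst.
  by exists u'; rewrite !inE pA.
case=> u; rewrite !inE => /andP[pA qA]; exists (u, c.1); first by rewrite mem_enum.
rewrite /= has_map; apply/hasP; exists (u, c.2); first by rewrite mem_enum.
by rewrite /matches /= !eqxx.
Qed.

Lemma authorized_users_sub (U R : finType) (A B : {set U * R}) r :
  A \subset B -> authorized_users A r \subset authorized_users B r.
Proof. by move=> sAB; apply/subsetP => u; rewrite !inE; apply: (subsetP sAB). Qed.

Lemma eligible_base (I : apep BoD_E) (A : {set users I * resources I}) :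
  valid I A -> eligible I (base I).
Proof.
case/and3P=> sAB _; apply: sub_all => c /set0Pn[u]; rewrite inE => /andP[u1 u2].
by apply/set0Pn; exists u; rewrite inE !(subsetP (authorized_users_sub _ sAB)).
Qed.

Lemma valid_base (I : apep BoD_E) : eligible I (base I) -> valid I (base I).
Proof.
move=> elig; rewrite /valid elig /authorized subxx andbT /=.
by apply/forallP => r; apply: base_nonempty.
Qed.

Theorem theorem10 : polynomial_time_solvable (D_APEP BoD_E).
Proof.
exists (tm_of_mach decide_base), 100, 4 => I.
pose es := map (@entry_of _ _) (enum (base I)).
pose cs := map (@entry_of _ _) (constraints I : seq (resources I * resources I)).
have satE : all (satisfied es) cs = eligible I (base I).
  by rewrite all_map; apply: eq_all => c; apply: satisfied_entries.
have := @runs_decide_base (encode_list (@encode_elt (users I)) (enum (users I)))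
  (encode_list (@encode_elt (resources I)) (enum (resources I))) es cs
  (no_bar_encode_elts _) (no_bar_encode_elts _) (digits_entries _) (digits_entries _).
rewrite satE -!encode_list_pairs.
have [elig|nelig] := boolP (eligible I (base I)) => Hrun.
  (* Instance and answer both list the relation in the order of [enum], so the copied section is
     literally the encoded answer. *)
  by exists (Some (base I)); first exact: valid_base.
exists None => // A validA.
by rewrite (eligible_base validA) in nelig.
Qed.
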